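(* Let $Q\in\mathbb{R}^{n\times n}$ be symmetric positive semidefinite, $c\in\mathbb{R}^n$, $\Omega>0$, and let $X=\{x\in\mathbb{R}^n: Ax=b,\ x\ge 0\}$ be a rational polyhedron. Then the problems $$(\mathrm{CO})\qquad \min\left\{c'x+\Omega\sqrt{x'Qx}:\ x\in X\right\}$$ and $$(\mathrm{PO})\qquad \min\left\{c'x+\frac{\Omega}{2}h(x,t)+\frac{\Omega}{2}t:\ x\in X,\ t\ge 0\right\}$$ are equivalent; that is, they have the same optimal objective value and there is a one-to-one correspondence between the optimal primal-dual pairs of both problems.
   Context: A prime denotes transposition. The function $h:\mathbb{R}^{n+1}\to\mathbb{R}_+\cup\{+\infty\}$ is defined by $h(x,t)=\frac{x'Qx}{t}$ if $t>0$; $h(x,t)=0$ if $x'Qx=0$ and $t=0$; and $h(x,t)=+\infty$ otherwise. In the primal-dual pairs, the dual variables are $\lambda$, associated with the constraints $Ax=b$, and $\mu$, associated with the constraints $x\ge 0$. *)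

(* Defs.v *)
From mathcomp Require Import all_boot all_order all_algebra.
From mathcomp Require Import all_classical all_reals ereal.

Set Implicit Arguments.
Unset Strict Implicit.
Unset Printing Implicit Defensive.

Import Order.TTheory GRing.Theory Num.Theory.
Local Open Scope classical_set_scope.
Local Open Scope ring_scope.

Section LinearAlgebra.
Context {R : realType} {n : nat}.

Definition dot (u v : 'cV[R]_n) : R := (u^T *m v) 0 0.

Definition quad (Q : 'M[R]_n) (x : 'cV[R]_n) : R := (x^T *m Q *m x) 0 0.

Definition psd (Q : 'M[R]_n) : Prop :=
  Q \is symmetricmx /\ forall x : 'cV[R]_n, 0 <= quad Q x.

Definition nonneg (x : 'cV[R]_n) : Prop := forall i, 0 <= x i 0.

(* Solution set of a finite system of linear inequalities with rational data. *)
Definition rational_polyhedron (X : set 'cV[R]_n) : Prop :=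
  exists (k : nat) (B : 'M[rat]_(k, n)) (d : 'cV[rat]_k),
    X = [set x | forall i, (map_mx ratr B *m x) i 0 <= ratr (d i 0)].

Definition std_polyhedron {m : nat} (A : 'M[R]_(m, n)) (b : 'cV[R]_m) :
    set 'cV[R]_n :=
  [set x | A *m x = b /\ nonneg x].

End LinearAlgebra.

(* Programs  min { f z : z in D, px z in std_polyhedron A b }  with an extended
   real objective.  The variables are z : T, of which px z is the part subject
   to A x = b and x >= 0.  Only these constraints are dualized, with
   multipliers lambda (free) and mu >= 0; the ground set D is kept in the
   minimization defining the dual function. *)
Section Programs.
Context {R : realType} {n m : nat} {T : Type}.
Variables (D : set T) (px : T -> 'cV[R]_n) (f : T -> \bar R).
Variables (A : 'M[R]_(m, n)) (b : 'cV[R]_m).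

Definition feasible : set T := [set z | D z /\ std_polyhedron A b (px z)].

(* +oo for an infeasible program, -oo for an unbounded one. *)
Definition optimal_value : \bar R := ereal_inf (f @` feasible).

Definition primal_optimal (z : T) : Prop :=
  feasible z /\ forall w, feasible w -> (f z <= f w)%E.

Definition lagrangian (z : T) (lambda : 'cV[R]_m) (mu : 'cV[R]_n) : \bar R :=
  (f z + (dot lambda (A *m px z - b) - dot mu (px z))%:E)%E.

Definition dual_function (lambda : 'cV[R]_m) (mu : 'cV[R]_n) : \bar R :=
  ereal_inf [set lagrangian z lambda mu | z in D].

Definition dual_optimal (lambda : 'cV[R]_m) (mu : 'cV[R]_n) : Prop :=
  nonneg mu /\ forall lambda' mu', nonneg mu' ->
    (dual_function lambda' mu' <= dual_function lambda mu)%E.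

(* Elements are (z, (lambda, mu)). *)
Definition optimal_pairs : set (T * ('cV[R]_m * 'cV[R]_n)) :=
  [set p | primal_optimal p.1 /\ dual_optimal p.2.1 p.2.2].

End Programs.

Section Problems.
Context {R : realType} {n m : nat}.
Variables (Q : 'M[R]_n) (c : 'cV[R]_n) (Omega : R).
Variables (A : 'M[R]_(m, n)) (b : 'cV[R]_m).

Definition h (x : 'cV[R]_n) (t : R) : \bar R :=
  if 0 < t then (quad Q x / t)%:E
  else if (quad Q x == 0) && (t == 0) then 0%E else +oo%E.

Definition CO_objective (x : 'cV[R]_n) : \bar R :=
  (dot c x + Omega * Num.sqrt (quad Q x))%:E.

Definition PO_objective (z : 'cV[R]_n * R) : \bar R :=
  ((dot c z.1)%:E + (Omega / 2)%:E * h z.1 z.2 + (Omega / 2 * z.2)%:E)%E.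

Definition PO_ground : set ('cV[R]_n * R) := [set z | 0 <= z.2].

Definition CO_value : \bar R := optimal_value setT id CO_objective A b.

Definition PO_value : \bar R := optimal_value PO_ground fst PO_objective A b.

Definition CO_optimal_pairs : set ('cV[R]_n * ('cV[R]_m * 'cV[R]_n)) :=
  optimal_pairs setT id CO_objective A b.

Definition PO_optimal_pairs : set (('cV[R]_n * R) * ('cV[R]_m * 'cV[R]_n)) :=
  optimal_pairs PO_ground fst PO_objective A b.

End Problems.

(* Main.v *)
(** For fixed [x], with [s = sqrt (x'Qx)], one has [s^2/t + t = 2 s + (s - t)^2/t]
    for [t > 0]: minimizing the objective of (PO) over [t >= 0] gives the
    objective of (CO), and [t = s] is the only minimizer.  The constraints
    involve [x] only, so this partial minimization preserves the optimal value,
    the dual function and the primal optimal solutions, and the correspondence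
    is [(x, (lambda, mu)) |-> ((x, s), (lambda, mu))]. *)
Require Import Defs.
From mathcomp Require Import all_boot all_order all_algebra.
From mathcomp Require Import all_classical all_reals ereal.
From mathcomp Require Import ring.
Set Implicit Arguments.
Unset Strict Implicit.
Unset Printing Implicit Defensive.

Import Order.TTheory GRing.Theory Num.Theory.
Local Open Scope classical_set_scope.
Local Open Scope ring_scope.

(** Via [p], every value of [g] is bounded below by a value of [f]; via [s], every value of [f] is a
    value of [g]. This serves for both the optimal values and the dual functions. *)
Lemma ereal_inf_partial_min (R : realType) (T U : Type) (A : set T) (B : set U)
    (f : T -> \bar R) (g : U -> \bar R) (p : U -> T) (s : T -> U) :
    (forall u, B u -> A (p u)) -> (forall u, B u -> (f (p u) <= g u)%E) ->
    (forall x, A x -> B (s x)) -> (forall x, A x -> g (s x) = f x) ->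
  ereal_inf (f @` A) = ereal_inf (g @` B).
Proof.
move=> pA fg sB gs; apply/eqP; rewrite eq_le; apply/andP; split.
  apply: le_ereal_inf_tmp => _ [u Bu <-]; apply: le_trans (fg u Bu).
  by apply: ereal_inf_lbound; exists (p u) => //; exact: pA.
apply: le_ereal_inf_tmp => _ [x Ax <-]; rewrite -gs //.
by apply: ereal_inf_lbound; exists (s x) => //; exact: sB.
Qed.

Section PartialMinimization.
Context {R : realType} {n m : nat}.
Variables (Q : 'M[R]_n) (c : 'cV[R]_n) (Omega : R).
Variables (A : 'M[R]_(m, n)) (b : 'cV[R]_m).
Hypotheses (Q_ge0 : forall x, 0 <= quad Q x) (Omega_gt0 : 0 < Omega).

Local Notation CO := (CO_objective Q c Omega).
Local Notation PO := (PO_objective Q c Omega).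
Local Notation sq x := (Num.sqrt (quad Q x)).

Lemma PO_objective_gt0 x t : 0 < t ->
  PO (x, t) = (CO x + (Omega / 2 * ((sq x - t) ^+ 2 / t))%:E)%E.
Proof.
move=> t0; rewrite /PO_objective /CO_objective /h /= t0 -EFinM -!EFinD.
(* Only the occurrence outside the root becomes a square, leaving a rational identity in [sq x] and
   [t]. *)
rewrite -{1}(sqr_sqrtr (Q_ge0 x)); congr EFin; field.
by rewrite gt_eqF.
Qed.

Lemma PO_objective_t0 x :
  PO (x, 0) = if quad Q x == 0 then CO x else +oo%E.
Proof.
rewrite /PO_objective /CO_objective /h /= ltxx eqxx andbT.
case: eqP => [->|_]; first by rewrite sqrtr0 !mulr0 mule0 !adde0 addr0.
by rewrite gt0_muley ?lte_fin ?divr_gt0.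
Qed.

Lemma PO_objective_sqrt x : PO (x, sq x) = CO x.
Proof.
(* If [quad Q x] vanishes, the minimizer is the boundary point [t = 0], where the convention 0/0 = 0
   in [h] applies. *)
have [q0|q0] := eqVneq (quad Q x) 0.
  by rewrite q0 sqrtr0 PO_objective_t0 q0 eqxx.
rewrite PO_objective_gt0 ?sqrtr_gt0 ?lt0r ?q0 ?Q_ge0 //.
by rewrite subrr expr0n mul0r mulr0 adde0.
Qed.

Lemma CO_le_PO x t : 0 <= t -> (CO x <= PO (x, t))%E.
Proof.
rewrite le_eqVlt => /predU1P[<-|t0].
  by rewrite PO_objective_t0; case: ifP => // _; rewrite leey.
rewrite PO_objective_gt0 // leeDl // lee_fin.
by rewrite mulr_ge0 ?divr_ge0 ?sqr_ge0 // ltW.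
Qed.

(** For [t > 0] the excess over [CO x] is a positive multiple of [(sq x - t) ^+ 2], so the square
    vanishes; at [t = 0], finiteness forces [quad Q x = 0]. *)
Lemma PO_le_CO_sqrt x t : 0 <= t -> (PO (x, t) <= CO x)%E -> t = sq x.
Proof.
rewrite le_eqVlt => /predU1P[<-|t0].
  by rewrite PO_objective_t0; case: eqP => [->|//]; rewrite sqrtr0.
rewrite PO_objective_gt0 // /CO_objective -EFinD lee_fin gerDl.
rewrite pmulr_rle0 ?divr_gt0 // pmulr_lle0 ?invr_gt0 // => sqr_le0.
apply/esym/eqP; rewrite -subr_eq0 -sqrf_eq0.
by rewrite eq_le sqr_le0 sqr_ge0.
Qed.

Lemma CO_value_eq_PO_value :
  CO_value Q c Omega A b = PO_value Q c Omega A b.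
Proof.
apply: (ereal_inf_partial_min (p := fst) (s := fun x => (x, sq x))).
- by move=> [x t] [].
- by move=> [x t] [t0 _]; exact: CO_le_PO.
- by move=> x [_ Xx]; split=> //; exact: sqrtr_ge0.
- by move=> x _; exact: PO_objective_sqrt.
Qed.

(** The multiplier term depends on [x] alone, so the Lagrangians compare exactly as the objectives
    do. *)
Lemma dual_function_CO_PO lambda mu :
  dual_function setT id CO A b lambda mu =
  dual_function PO_ground fst PO A b lambda mu.
Proof.
apply: (ereal_inf_partial_min (p := fst) (s := fun x => (x, sq x))) => //.
- by move=> [x t] t0; rewrite leeD2r // CO_le_PO.
- by move=> x _; exact: sqrtr_ge0.
- by move=> x _; rewrite /lagrangian /= PO_objective_sqrt.
Qed.

Lemma dual_optimal_CO_PO lambda mu :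
  dual_optimal setT id CO A b lambda mu <->
  dual_optimal PO_ground fst PO A b lambda mu.
Proof.
by split=> -[mu0 opt]; split=> // lambda' mu' /(opt lambda');
  rewrite !dual_function_CO_PO.
Qed.

Lemma primal_optimal_CO_PO x t :
  primal_optimal PO_ground fst PO A b (x, t) <->
  primal_optimal setT id CO A b x /\ t = sq x.
Proof.
split=> [[[/= t0 Xx] opt]|[[[_ Xx] opt] ->]]; last first.
  split=> [|[y s] [s0 Xy]]; first by split=> //; exact: sqrtr_ge0.
  by rewrite PO_objective_sqrt (le_trans (opt y _)) ?CO_le_PO.
(* Testing optimality against [(y, sq y)] gives this bound; [y = x] then determines [t], and general
   [y] gives optimality of [x]. *)
have PO_le y : std_polyhedron A b y -> (PO (x, t) <= CO y)%E.
  move=> Xy; rewrite -PO_objective_sqrt; apply: opt.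
  by split=> //; exact: sqrtr_ge0.
split; last exact/PO_le_CO_sqrt/PO_le.
by split=> // y [_ Xy]; rewrite (le_trans (CO_le_PO x t0)) ?PO_le.
Qed.

End PartialMinimization.

Theorem proposition2 (R : realType) (n m : nat) (Q : 'M[R]_n) (c : 'cV[R]_n)
    (Omega : R) (A : 'M[R]_(m, n)) (b : 'cV[R]_m)
    (Q_psd : psd Q) (Omega_gt0 : 0 < Omega)
    (X_rational : rational_polyhedron (std_polyhedron A b)) :
  CO_value Q c Omega A b = PO_value Q c Omega A b
  /\ exists phi : 'cV[R]_n * ('cV[R]_m * 'cV[R]_n) ->
                  ('cV[R]_n * R) * ('cV[R]_m * 'cV[R]_n),
       set_bij (CO_optimal_pairs Q c Omega A b)
               (PO_optimal_pairs Q c Omega A b) phi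
       /\ forall p, CO_optimal_pairs Q c Omega A b p ->
            (phi p).1.1 = p.1 /\ (phi p).2 = p.2.
Proof.
have [_ Q_ge0] := Q_psd; split; first exact: CO_value_eq_PO_value.
exists (fun p => ((p.1, Num.sqrt (quad Q p.1)), p.2)); split=> //; split.
- move=> [x [lambda mu]] [/= xopt dopt]; split=> /=.
    exact/primal_optimal_CO_PO.
  exact/(dual_optimal_CO_PO _ _ _ Q_ge0 Omega_gt0).
- by move=> [x d] [y d'] _ _ [-> _ ->].
(* Surjectivity: optimality forces [t] to be the root, so dropping [t] gives a preimage. *)
- move=> [[x t] [lambda mu]] [/= /primal_optimal_CO_PO[] // xopt -> dopt].
  exists (x, (lambda, mu)) => //; split=> //=.
  exact/(dual_optimal_CO_PO _ _ _ Q_ge0 Omega_gt0).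
Qed.
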